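(* Let $T$ be a tree of order $n \ge 4$. If $\gamma_{nt}(T) = n/2$, then $T \in \mathcal{T}$.
   Context: All graphs are finite and simple. For a vertex $v$ of a graph $G$, $N(v)$ denotes its open neighborhood (the set of neighbors of $v$); for $S \subseteq V(G)$, $N(S) = \bigcup_{v \in S} N(v)$ and $N[S] = N(S) \cup S$. A neighborhood total dominating set (NTD-set) of $G$ is a set $S \subseteq V(G)$ that is a dominating set of $G$ (i.e. $N[S] = V(G)$) such that the subgraph of $G$ induced by $N(S)$ has no isolated vertex. The neighborhood total domination number $\gamma_{nt}(G)$ is the minimum cardinality of an NTD-set of $G$. A $2$-packing in a graph is a set of vertices pairwise at distance at least $3$. The family $\mathcal{T}$ of trees is defined as follows. Let $T_0$ be an arbitrary tree. Let $T_1$ be the tree obtained from $T_0$ by doing, for each vertex $x \in V(T_0)$, exactly one of the following: either add one new vertex and an edge joining it to $x$, or add a new path $P_3$ (on three new vertices) and an edge joining the central vertex of this $P_3$ to $x$. Then $\mathcal{T}$ is the family of all trees $T$ that can be obtained from such a $T_1$ by the following operation: choose a set $L_1$ of leaves of $T_1$ that forms a $2$-packing in $T_1$ (possibly $L_1 = \emptyset$), and for each vertex $v \in L_1$ add some number $k \ge 0$ of vertex-disjoint new copies of $P_2$ and join $v$ by an edge to exactly one end of each added copy of $P_2$. *)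

(* Defs.v *)
From mathcomp Require Import all_boot.
Set Implicit Arguments. Unset Strict Implicit. Unset Printing Implicit Defensive.

Section Graphs.
Variable V : finType.
Implicit Types (e : rel V) (S : {set V}).

Definition simple_graph e := symmetric e /\ irreflexive e.

Definition nbh e (v : V) : {set V} := [set u | e v u].
Definition nbhS e S : {set V} := \bigcup_(v in S) nbh e v.
Definition cnbhS e S : {set V} := nbhS e S :|: S.

Definition dominating e S : bool := cnbhS e S == [set: V].

Definition ntd_set e S : bool :=
  dominating e S && [forall u in nbhS e S, exists w in nbhS e S, e u w].

(* minimum cardinality of an NTD-set (V itself is always an NTD-set, so the
   default value #|V| is never strictly below the true minimum) *)
Definition gamma_nt e : nat :=
  \big[minn/#|V|]_(S : {set V} | ntd_set e S) #|S|.

Definition acyclic e :=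
  ~ exists (x : V) (p : seq V),
      [/\ uniq (x :: p), 2 <= size p, path e x p & e (last x p) x].

Definition connected e := forall x y : V, connect e x y.

Definition is_tree e := [/\ simple_graph e, 0 < #|V|, connected e & acyclic e].

Definition is_leaf e (v : V) : bool := #|nbh e v| == 1.

(* 2-packing: distinct vertices are pairwise at distance >= 3, i.e. they are
   non-adjacent and have no common neighbour *)
Definition two_packing e S :=
  forall u v, u \in S -> v \in S -> u != v ->
    ~~ e u v /\ ~ (exists w, e u w && e w v).

End Graphs.

(* Vertices of T1 built from T0 on U: the old vertices (inl x), and for each
   x a new gadget: one vertex ('I_1) if c x = false, a P3 ('I_3, central vertex
   of index 1) if c x = true. *)
Notation V1 U c := (U + {x : U & 'I_(if c x then 3 else 1)})%type.

Definition e1 (U : finType) (e0 : rel U) (c : U -> bool) : rel (V1 U c) :=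
  fun a b =>
    match a, b with
    | inl x, inl y => e0 x y
    | inl x, inr (existT y j) | inr (existT y j), inl x =>
        (x == y) && (if c y then val j == 1 else true)
    | inr (existT x i), inr (existT y j) =>
        (x == y) && c x && (((val i == 1) && (val j != 1)) || ((val j == 1) && (val i != 1)))
    end.

(* Vertices of the final tree: the vertices of T1, and for each v of T1,
   k v copies of P2 (ends false/true); the end 'false' is joined to v. *)
Notation V2 U c k :=
  (V1 U c + {v : V1 U c & ('I_(k v) * bool)%type})%type.

Definition e2 (U : finType) (e0 : rel U) (c : U -> bool) (k : V1 U c -> nat)
  : rel (V2 U c k) :=
  fun a b =>
    match a, b with
    | inl x, inl y => @e1 U e0 c x y
    | inl x, inr (existT v (_, t)) | inr (existT v (_, t)), inl x =>
        (x == v) && ~~ t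
    | inr (existT v (i, s)), inr (existT w (j, t)) =>
        (v == w) && (val i == val j) && (s != t)
    end.

Definition in_family_T (V : finType) (e : rel V) : Prop :=
  exists (U : finType) (e0 : rel U) (c : U -> bool)
         (L1 : {set V1 U c}) (k : V1 U c -> nat),
    [/\ is_tree e0,
        (forall v, v \in L1 -> is_leaf (@e1 U e0 c) v),
        two_packing (@e1 U e0 c) L1,
        (forall v, v \notin L1 -> k v = 0) &
        exists f : V -> V2 U c k,
          bijective f /\ forall x y, e x y = @e2 U e0 c k (f x) (f y)].

(* Main.v *)
(* Root the tree and split it along edges into rooted subtrees.  An NTD-set is
   the same as a labelling of the vertices subject to conditions relating each
   label to the labels of its neighbours, and so is a decomposition witnessing
   membership in the family: both are runs of a tree automaton.  For every
   rooted subtree with vertex set W record the parity of |W|, the root states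
   reachable by partial runs, and for each of them an upper bound on
   2|S| - |W|, where S is the set of chosen vertices.  Summaries of the two
   halves give one of the whole.  If bounds below -2 are weakened to -2 and
   those above 1 forgotten, only finitely many summaries remain, and computing
   a set of them closed under joining (up to weakening) shows that each forces
   odd order, or an NTD-set of size < n/2, or membership in the family. *)
From HB Require Import structures.
From mathcomp Require Import all_boot zify.
Require Import Defs.
Set Implicit Arguments. Unset Strict Implicit. Unset Printing Implicit Defensive.

(** * Labels, states and summaries of the tree automaton *)

(* In an NTD-set S, the vertices of S are Chosen or Backed; a Backed one must
   have a neighbour in S, and only a Backed one may be relied upon for having
   such a neighbour.  In the family, Base vertices are those of T_0, an added
   P_3 is Pendant - Hub - Centre, an added single vertex is a Centre, and the
   P_2's are Inner - Outer with Inner attached to a Centre. *)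
Inductive label :=
  Chosen | Backed | Unchosen | Base | Hub | Pendant | Centre | Inner | Outer.

Scheme Equality for label.

Lemma label_eqP : Equality.axiom label_beq.
Proof. by case; case; constructor. Qed.
HB.instance Definition _ := hasDecEq.Build label label_eqP.

Definition chosen (l : label) := l \in [:: Chosen; Backed].
Definition ntd_label (l : label) := l \in [:: Chosen; Backed; Unchosen].

(* Each listed set of labels must occur among the neighbours; for a role in the
   family it must occur exactly once. *)
Definition demands (l : label) : seq (seq label) :=
  match l with
  | Chosen => [::]
  | Backed => [:: [:: Chosen; Backed]]
  | Unchosen => [:: [:: Chosen; Backed]; [:: Backed; Unchosen]]
  | Base => [:: [:: Hub; Centre]]
  | Hub => [:: [:: Base]; [:: Pendant]; [:: Centre]]
  | Pendant => [:: [:: Hub]]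
  | Centre => [:: [:: Base; Hub]]
  | Inner => [:: [:: Centre]; [:: Outer]]
  | Outer => [:: [:: Inner]]
  end.

Definition allowed (l : label) : seq label :=
  match l with
  | Chosen | Backed | Unchosen => [:: Chosen; Backed; Unchosen]
  | Base => [:: Base; Hub; Centre]
  | Hub => [:: Base; Pendant; Centre]
  | Pendant => [:: Hub]
  | Centre => [:: Base; Hub; Inner]
  | Inner => [:: Centre; Outer]
  | Outer => [:: Inner]
  end.

(* The label of the root, and which of its demands are met so far. *)
Definition state := (label * seq bool)%type.

(* The parity of |W|, then the entries; an entry (q, b) stands for a run ending
   in state q with 2|S| + 2 <= |W| + b. *)
Definition summary := (bool * seq (state * nat))%type.

(** A role meets each demand exactly once, so meeting one a second time kills the run; demands of
    NTD labels may be met repeatedly. *)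
Definition receive (q : state) (a : label) : option state :=
  let fs := zip q.2 [seq a \in d | d <- demands q.1] in
  if (a \in allowed q.1) && (ntd_label q.1 || ~~ has (fun f => f.1 && f.2) fs)
  then Some (q.1, [seq f.1 || f.2 | f <- fs]) else None.

(** The first root stays the root. The second gets no neighbours after this one, so its demands must
    now all be met. *)
Definition graft_state (q1 q2 : state) : option state :=
  if receive q2 q1.1 is Some q then
    if all id q.2 then receive q1 q2.1 else None
  else None.

(** Bounds carry an offset of 2, so 3 stands for $2|S| - |W| \le 1$. *)
Definition cap := 3.

Definition dominated (t : seq (state * nat)) (x : state * nat) :=
  has (fun y => (y.1 == x.1) && (y.2 <= x.2)) t.

Definition add_entry (t : seq (state * nat)) (x : state * nat) :=
  if (cap < x.2) || dominated t x then t
  else x :: filter (fun y => ~~ dominated [:: x] y) t.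

(* The truncated subtraction clips the bound from below. *)
Definition graft_entry (x1 x2 : state * nat) : option (state * nat) :=
  omap (fun q => (q, x1.2 + x2.2 - 2)) (graft_state x1.1 x2.1).

Definition graft (s1 s2 : summary) : summary :=
  (s1.1 (+) s2.1,
   foldl add_entry [::]
     (pmap id [seq graft_entry x1 x2 | x1 <- s1.2, x2 <- s2.2])).

Definition weaker (s t : summary) := (s.1 == t.1) && all (dominated t.2) s.2.

(** With $|W| = 1$ and the offset 2, the bound is $2 - 1 + 2$ for a chosen vertex and $0 - 1 + 2$
    for any other. *)
Definition leaf_summary : summary :=
  (true, [seq ((l, nseq (size (demands l)) false), (chosen l).*2.+1)
   | l <- [:: Chosen; Backed; Unchosen; Base; Hub; Pendant; Centre; Inner; Outer]]).

(** Only the weakest summaries are kept: a subtree described by a stronger one is described by a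
    weaker one as well. *)
Definition add_summary (T : seq summary) (s : summary) :=
  if has (fun t => weaker t s) T then T
  else s :: filter (fun t => ~~ weaker s t) T.

Definition extend (T : seq summary) :=
  foldl add_summary T [seq graft s t | s <- T, t <- T].

(* Ten rounds reach the fixpoint. *)
Definition summaries := iter 10 extend [:: leaf_summary].

(** The three outcomes: odd order, a finished run of roles, or a finished NTD run with $2|S| < |W|$,
    which is what a bound below 2 encodes. *)
Definition accepting (s : summary) :=
  s.1 || has (fun x => all id x.1.2 && (~~ ntd_label x.1.1 || (x.2 < 2))) s.2.

(** * Partial labellings of rooted subtrees and soundness of the summaries *)

Section Labellings.
Variables (V : finType) (e : rel V).
Hypotheses (e_sym : symmetric e) (e_irr : irreflexive e).
Implicit Types (A B W : {set V}) (L : V -> label).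

(** Joining two roots by an edge is the only step, so inductions need not treat vertices with many
    children separately. *)
Inductive assembled : {set V} -> V -> Prop :=
| Single r : assembled [set r] r
| Graft W1 r1 W2 r2 :
    assembled W1 r1 -> assembled W2 r2 -> [disjoint W1 & W2] ->
    (forall a b, a \in W1 -> b \in W2 -> e a b = (a == r1) && (b == r2)) ->
    assembled (W1 :|: W2) r1.

Lemma assembled_root W r : assembled W r -> r \in W.
Proof. by elim=> [x|W1 r1 W2 r2 _ h _ _ _ _]; rewrite !inE ?eqxx ?h. Qed.

Definition received W L v (d : seq label) :=
  \sum_(u in W) (e v u && (L u \in d) : nat).

(** What holds at [v] while neighbours outside [W] may still come: demands can be open, but no role
    has exceeded one. *)
Definition consistent W L v :=
  (forall u, u \in W -> e v u -> L u \in allowed (L v)) /\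
  (~~ ntd_label (L v) -> all (fun d => received W L v d <= 1) (demands (L v))).

Definition satisfied W L v := [seq 0 < received W L v d | d <- demands (L v)].

Definition complete W L v := consistent W L v /\ all id (satisfied W L v).

(** Later joins add neighbours to the root alone, so every other vertex has to be complete
    already. *)
Definition realized W r (x : state * nat) := exists L,
  [/\ (L r, satisfied W L r) = x.1, consistent W L r,
      forall v, v \in W -> v != r -> complete W L v &
      (\sum_(v in W) chosen (L v)).*2.+2 <= #|W| + x.2].

Definition valid W r (s : summary) :=
  s.1 = odd #|W| /\ forall x, x \in s.2 -> realized W r x.

Lemma realized_weaken W r x y :
  realized W r y -> y.1 = x.1 -> y.2 <= x.2 -> realized W r x.
Proof.
move=> [L [h1 h2 h3 h4]] exy lexy; exists L; split=> //; first by rewrite h1.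
by apply: leq_trans h4 _; rewrite leq_add2l.
Qed.

Lemma valid_weaken W r s t : weaker s t -> valid W r t -> valid W r s.
Proof.
move=> /andP[/eqP h1 /allP h2] [ht1 ht2]; split; first by rewrite h1.
move=> x /h2/hasP[y /ht2 hy /andP[/eqP e1 l1]].
exact: realized_weaken hy e1 l1.
Qed.

Lemma valid_leaf r : valid [set r] r leaf_summary.
Proof.
split=> [|x /mapP[l _ ->]]; first by rewrite cards1.
have rec0 d : received [set r] (fun=> l) r d = 0.
  by rewrite /received big_set1 e_irr.
exists (fun=> l); split=> /=.
- rewrite /satisfied; congr pair; elim: (demands l) => //= d ds ->.
  by rewrite rec0.
- split=> [u|_]; first by rewrite inE => /eqP->; rewrite e_irr.
  by apply/allP=> d _; rewrite rec0.
- by move=> v; rewrite inE => ->.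
- by rewrite cards1 big_set1 /=; case: (chosen l).
Qed.

(** This ties [receive] to actual counts: from [W] to [W'] the vertex [v] gains one neighbour,
    labelled [a]. *)
Lemma received_consistent W W' L L' v q a :
  (L v, satisfied W L v) = q -> consistent W L v -> L' v = L v ->
  (forall d, received W' L' v d = received W L v d + (a \in d)) ->
  (forall u, u \in W' -> e v u -> (u \in W) && (L' u == L u) || (L' u == a)) ->
  forall q', receive q a = Some q' ->
  (L' v, satisfied W' L' v) = q' /\ consistent W' L' v.
Proof.
move=> <- [all_v one_v] eL rec nbr q'; rewrite /receive /=.
rewrite /satisfied /consistent eL zip_map has_map -map_comp.
case: ifP => // /andP[a_ok twice [<-]]; split.
  by congr pair; apply: eq_map => d /=; rewrite rec addn_gt0; case: (a \in d).
split=> [u uW' evu|not_ntd].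
  case/orP: (nbr _ uW' evu) => [/andP[uW /eqP->]|/eqP->] //; exact: all_v.
(* If [a] meets [d], then [twice] makes the old count 0 and the new one 1; otherwise the count does
   not change. *)
move: twice; rewrite (negPf not_ntd) /= => /hasPn twice.
apply/allP=> d dd; rewrite rec; have /= := twice d dd.
by have := allP (one_v not_ntd) d dd; case: (a \in d) => /=; lia.
Qed.

Lemma foldl_add_entry (ok : state * nat -> Prop) t s :
  (forall x, x \in t -> ok x) -> (forall x, x \in s -> ok x) ->
  forall x, x \in foldl add_entry t s -> ok x.
Proof.
elim: s t => //= y s IHs t ok_t ok_s; apply: IHs; last first.
  by move=> x xs; apply: ok_s; rewrite inE xs orbT.
rewrite /add_entry; case: ifP => // _ x; rewrite inE mem_filter.
case/orP=> [/eqP->|/andP[_]]; last exact: ok_t.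
by apply: ok_s; rewrite inE eqxx.
Qed.

(** The edge between the roots is the only one across, so within [A] only [rA] sees a new neighbour,
    namely [rB]. *)
Lemma received_join A B rA rB LA L v d :
    [disjoint A & B] -> rB \in B ->
    (forall a b, a \in A -> b \in B -> e a b = (a == rA) && (b == rB)) ->
    {in A, L =1 LA} -> v \in A ->
  received (A :|: B) L v d = received A LA v d + ((v == rA) && (L rB \in d)).
Proof.
move=> dis rB_B cross eL vA.
rewrite {1}/received (eq_bigl [predU A & B]) => [|u]; last by rewrite !inE.
rewrite bigU //=; congr (_ + _).
  by apply: eq_bigr => u uA; rewrite eL.
rewrite (bigD1 rB) //= big1 => [|u /andP[uB /negPf neq]].
  by rewrite addn0 cross // eqxx andbT.
by rewrite cross // neq andbF.
Qed.

Lemma complete_join A B rA rB LA L v :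
    [disjoint A & B] -> rB \in B ->
    (forall a b, a \in A -> b \in B -> e a b = (a == rA) && (b == rB)) ->
    {in A, L =1 LA} -> v \in A -> v != rA ->
  complete A LA v -> complete (A :|: B) L v.
Proof.
move=> dis rB_B cross eL vA neq [[c1 c2] c3].
have rec d : received (A :|: B) L v d = received A LA v d.
  by rewrite (received_join d dis rB_B cross eL vA) (negPf neq) addn0.
split; last first.
  rewrite /satisfied eL // (eq_map (g := fun d => 0 < received A LA v d)) //.
  by move=> d; rewrite rec.
split=> [u|]; last by rewrite eL // => /c2; apply: sub_all => d; rewrite rec.
rewrite inE (eL v vA) => /orP[uA|uB]; first by rewrite eL //; apply: c1.
by rewrite cross // (negPf neq).
Qed.

Lemma graft_consistent A B rA rB LA L q a q' :
    [disjoint A & B] -> rA \in A -> rB \in B ->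
    (forall a b, a \in A -> b \in B -> e a b = (a == rA) && (b == rB)) ->
    {in A, L =1 LA} -> L rB = a ->
    (LA rA, satisfied A LA rA) = q -> consistent A LA rA ->
  receive q a = Some q' ->
  (L rA, satisfied (A :|: B) L rA) = q' /\ consistent (A :|: B) L rA.
Proof.
move=> dis rA_A rB_B cross eL <- eq cons.
apply: received_consistent eq cons _ _ _ _ => //; first exact: eL.
  by move=> d; rewrite (received_join d dis rB_B cross eL rA_A) eqxx.
move=> u; rewrite inE => /orP[uA|uB]; first by rewrite uA eL // eqxx.
by rewrite cross // eqxx => /eqP->; rewrite eqxx orbT.
Qed.

(** The two labellings are glued. Only the roots gain a neighbour, and [graft_state] has checked
    both of them. *)
Lemma realized_graft W1 W2 r1 r2 x1 x2 x :
    [disjoint W1 & W2] -> r1 \in W1 -> r2 \in W2 ->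
    (forall a b, a \in W1 -> b \in W2 -> e a b = (a == r1) && (b == r2)) ->
    realized W1 r1 x1 -> realized W2 r2 x2 -> graft_entry x1 x2 = Some x ->
  realized (W1 :|: W2) r1 x.
Proof.
move=> dis r1W r2W cross [L1 [q1E c1 all1 card1]] [L2 [q2E c2 all2 card2]].
rewrite /graft_entry /graft_state -q1E -q2E.
case rec2: receive => [q2'|] //; case: ifP => // fin2.
case rec1: receive => [q1'|] //= [<-].
pose L v := if v \in W2 then L2 v else L1 v.
have L1E : {in W1, L =1 L1} by move=> v vW; rewrite /L (disjointFr dis vW).
have L2E : {in W2, L =1 L2} by move=> v vW; rewrite /L vW.
have dis' : [disjoint W2 & W1] by rewrite disjoint_sym.
have cross' a b : a \in W2 -> b \in W1 -> e a b = (a == r2) && (b == r1).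
  by move=> aW bW; rewrite e_sym cross // andbC.
have [s1 d1] := graft_consistent dis r1W r2W cross L1E (L2E _ r2W) erefl c1 rec1.
have [s2 d2] := graft_consistent dis' r2W r1W cross' L2E (L1E _ r1W) erefl c2 rec2.
exists L; split=> // [v|].
  rewrite inE => /orP[vW|vW] neq.
    exact: (complete_join dis r2W cross L1E vW neq (all1 v vW neq)).
  rewrite setUC; have [->|neq2] := eqVneq v r2; first by split=> //; rewrite -s2 in fin2.
  exact: (complete_join dis' r1W cross' L2E vW neq2 (all2 v vW neq2)).
have cardW : #|W1 :|: W2| = #|W1| + #|W2|.
  by rewrite cardsU disjoint_setI0 // cards0 subn0.
have sumW : \sum_(v in W1 :|: W2) chosen (L v) =
    \sum_(v in W1) chosen (L1 v) + \sum_(v in W2) chosen (L2 v).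
  rewrite (eq_bigl [predU W1 & W2]) => [|v]; last by rewrite !inE.
  rewrite bigU //=.
  by congr (_ + _); apply: eq_bigr => v vW; [rewrite L1E|rewrite L2E].
(* Adding the two bounds counts the offset twice, whence the [- 2]; truncation can only enlarge the
   bound. *)
move: card1 card2; rewrite cardW sumW /=; lia.
Qed.

Lemma valid_graft W1 W2 r1 r2 s1 s2 :
    [disjoint W1 & W2] -> r1 \in W1 -> r2 \in W2 ->
    (forall a b, a \in W1 -> b \in W2 -> e a b = (a == r1) && (b == r2)) ->
    valid W1 r1 s1 -> valid W2 r2 s2 ->
  valid (W1 :|: W2) r1 (graft s1 s2).
Proof.
move=> dis r1W r2W cross [par1 ok1] [par2 ok2]; split=> /=.
  by rewrite cardsU disjoint_setI0 // cards0 subn0 oddD par1 par2.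
apply: foldl_add_entry => // x; rewrite mem_pmap map_id => /allpairsP[[x1 x2] /= [m1 m2 ex]].
exact: realized_graft dis r1W r2W cross (ok1 _ m1) (ok2 _ m2) (esym ex).
Qed.

(** The finite check. All properties are tested on the computed list itself, so nothing need be
    proved about [extend]; the existential then hides the list. *)
Lemma summaries_correct :
  exists2 T, has (fun t => weaker t leaf_summary) T &
    all accepting T && all (fun s => all (fun t => has (weaker^~ (graft s t)) T) T) T.
Proof. by exists summaries; vm_compute. Qed.

(** Along the assembly some member of [T] stays valid: closure of [T] allows weakening back into it
    after each join. *)
Lemma assembled_accepting W r : assembled W r ->
  exists2 s, accepting s & valid W r s.
Proof.
have [T leaf_ok /andP[acc_ok graft_ok]] := summaries_correct.
move=> asm; suff [s sT val_s] : exists2 s, s \in T & valid W r s.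
  by exists s => //; apply: (allP acc_ok).
elim: asm => {W r} [r|W1 r1 W2 r2 asm1 [s1 T1 v1] asm2 [s2 T2 v2] dis cross].
  by have /hasP[s sT le] := leaf_ok; exists s => //; apply: valid_weaken le (valid_leaf r).
have /hasP[s sT le] := allP (allP graft_ok s1 T1) s2 T2.
exists s => //; apply: valid_weaken le _.
exact: valid_graft dis (assembled_root asm1) (assembled_root asm2) cross v1 v2.
Qed.

End Labellings.

(** * Splitting a tree along edges into rooted subtrees *)

Section TreeAssembly.
Variables (V : finType) (e : rel V).
Hypotheses (e_sym : symmetric e) (e_irr : irreflexive e).
Hypothesis e_acyclic : acyclic e.
Implicit Types W : {set V}.

Definition inside W : rel V := [rel x y | [&& x \in W, y \in W & e x y]].

Lemma inside_sym W : symmetric (inside W).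
Proof. by move=> x y; rewrite /inside /= e_sym andbCA. Qed.

Lemma inside_connect_sym W : connect_sym (inside W).
Proof. exact/sym_connect_sym/inside_sym. Qed.

Lemma inside_path W x p : x \in W -> path e x p -> {subset p <= W} ->
  path (inside W) x p.
Proof.
rewrite /inside; elim: p x => //= y p IHp x xW /andP[exy py] sub.
have yW : y \in W by apply: sub; rewrite inE eqxx.
by rewrite xW yW exy IHp // => z zp; apply: sub; rewrite inE zp orbT.
Qed.

Lemma path_inside W x p : path (inside W) x p -> path e x p /\ {subset p <= W}.
Proof.
rewrite /inside; elim: p x => //= y p IHp x /andP[/and3P[_ yW ->] /IHp[-> sub]]; split=> // z.
by rewrite inE => /orP[/eqP->|/sub].
Qed.

(** Take a neighbour [r2] of [r]. Its component in [W] without [r] is one half; the rest, connected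
    through [r], is the other. Acyclicity leaves a single edge across. *)
Lemma connected_assembled W r :
    r \in W -> (forall w, w \in W -> connect (inside W) r w) ->
  assembled e W r.
Proof.
have [n] := ubnP #|W|; elim: n => // n IHn in W r *; rewrite ltnS => leWn rW conW.
have [/eqP W1|[w]] := set_0Vmem (W :\ r).
  rewrite setD_eq0 in W1.
  have -> : W = [set r] by apply/eqP; rewrite eqEsubset W1 sub1set.
  exact: Single.
rewrite !inE => /andP[w_r /conW/connectP[p pth lastp]].
have [r2 r2W e_r_r2] : exists2 r2, r2 \in W & e r r2.
  case: p pth lastp => [|r2 p] /=; first by move=> _ er; rewrite er eqxx in w_r.
  by case/andP=> /and3P[_ r2W err2] _ _; exists r2.
have {w p w_r pth lastp} r2_r : r2 != r by apply: contraTneq e_r_r2 => ->; rewrite e_irr.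
pose W' := W :\ r; have r2W' : r2 \in W' by rewrite !inE r2_r.
pose W2 := [set w | connect (inside W') r2 w].
have W2_step a b : a \in W' -> b \in W' -> e a b -> (a \in W2) = (b \in W2).
  move=> aW' bW' eab; rewrite !inE; apply: same_connect_r.
    exact: inside_connect_sym.
  by apply: connect1; rewrite /inside /= aW' bW'.
have sub2 : W2 \subset W'.
  apply/subsetP=> v; rewrite inE => /connectP[q /path_inside[_ sub] ->].
  by have := mem_last r2 q; rewrite inE => /orP[/eqP->|/sub].
have r2W2 : r2 \in W2 by rewrite inE connect0.
pose W1 := W :\: W2.
have defW : W = W1 :|: W2.
  by rewrite setUC -[LHS](setID W W2) (setIidPr _) //; apply: subset_trans sub2 (subD1set _ _).
have rW1 : r \in W1.
  by rewrite inE rW andbT; apply/negP=> /(subsetP sub2); rewrite !inE eqxx.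
have lt2 : #|W2| < n.
  apply: leq_trans leWn; apply: leq_ltn_trans (subset_leq_card sub2) _.
  by rewrite [X in _ < X](cardsD1 r) rW.
have lt1 : #|W1| < n.
  apply: leq_trans leWn; apply: proper_card; rewrite properE subsetDl.
  by apply/subsetPn; exists r2; rewrite // inE r2W2.
have dis : [disjoint W1 & W2].
  by rewrite -setI_eq0; apply/eqP/setP=> v; rewrite !inE; case: connect; rewrite ?andbF.
rewrite defW; apply: (@Graft _ _ W1 r W2 r2) => // [||a b].
(* A simple path from [r] never returns to [r], so past [r] it runs in [W'], where no edge enters or
   leaves [W2]. Ending outside [W2], it avoids [W2]. *)
- apply: IHn => // v vW1; have /conW/connectP[q pth lastq] : v \in W by case/setDP: vW1.
  case/shortenP: pth lastq => {}q /path_inside[pq subq] uq _ lastq.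
  apply/connectP; exists q => //; apply: inside_path => //.
  have {uq} subq' : {subset q <= W'}.
    move=> z zq; rewrite !inE subq // andbT; apply: contraTneq zq => ->.
    by case/andP: uq.
  case: q pq lastq subq' {subq} => //= a q /andP[_ pq] lastq sub.
  rewrite {}lastq in vW1 *; case/setDP: vW1 => _.
  elim: q a pq sub => /= [|b q IHq] a pq sub notW2 z.
    rewrite inE => /eqP->; rewrite inE notW2.
    by have := sub a (mem_head _ _); rewrite inE => /andP[].
  have [eab pq'] := andP pq; have aW' := sub a (mem_head _ _).
  have {}IHq := IHq b pq' (fun z zq => sub z (@mem_behead _ (a :: b :: q) z zq)) notW2.
  rewrite inE => /predU1P[->|]; last exact: IHq.
  have bW1 := IHq b (mem_head _ _).
  have bW' : b \in W' by apply: sub; rewrite inE mem_head orbT.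
  rewrite inE (W2_step a b) //; case/setDP: bW1 => _ ->.
  by case/setD1P: aW'.
- apply: IHn => // v; rewrite inE => /connectP[q /path_inside[pq sub] ->].
  apply/connectP; exists q => //; apply: inside_path => //.
  elim: {v} q (r2) r2W' r2W2 pq sub => //= v q IHq a aW' aW2 /andP[eav pq] sub z.
  have vW' : v \in W' by apply: sub; rewrite mem_head.
  have vW2 : v \in W2 by rewrite -(W2_step a).
  rewrite inE => /predU1P[->|] //; apply: IHq pq _ _ => // t tq.
  by apply: sub; rewrite inE tq orbT.
- move=> aW1 bW2; have bW' := subsetP sub2 b bW2; have [b_r bW] := setD1P bW'.
  have [aW naW2] := setDP aW1.
  apply/idP/andP=> [eab|[/eqP-> /eqP->]] //.
  have a_r : a == r.
    apply: contraNT naW2 => a_r; rewrite (W2_step a b) //.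
    by rewrite !inE a_r.
  (* If [b] differs from [r2], a simple path from [r2] to [b] in [W'] closes a cycle through [r]. *)
  split=> //; apply/negPn/negP=> b_r2; rewrite (eqP a_r) in eab.
  move: bW2; rewrite inE => /connectP[q pth lastq].
  case/shortenP: pth lastq => {}q /path_inside[pq subq] uq _ lastq.
  apply: e_acyclic; exists r, (r2 :: q); split.
  - rewrite cons_uniq uq andbT; apply/negP; rewrite inE eq_sym (negPf r2_r) /=.
    by move=> /subq; rewrite !inE eqxx.
  - by case: q lastq {pq subq uq} => //= eb; rewrite eb eqxx in b_r2.
  - by rewrite /= e_r_r2.
  - by rewrite /= -lastq e_sym.
Qed.

End TreeAssembly.

Lemma tree_assembled (V : finType) (e : rel V) (r : V) :
  is_tree e -> assembled e [set: V] r.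
Proof.
case=> [[e_sym e_irr] _ conn acyc].
apply: connected_assembled => // w _.
have /connectP[p pth ->] := conn r w.
by apply/connectP; exists p => //; apply: inside_path => // z _; rewrite inE.
Qed.

(** * Complete labellings of the whole graph and their NTD-sets *)

Section Labelled.
Variables (V : finType) (e : rel V) (L : V -> label).
Hypothesis e_sym : symmetric e.
Hypothesis L_complete : forall v, complete e [set: V] L v.

Lemma allowed_edge v u : e v u -> L u \in allowed (L v).
Proof. by have [[adm _] _] := L_complete v; apply: adm; rewrite inE. Qed.

Lemma demand_met v d : d \in demands (L v) -> exists2 u, e v u & L u \in d.
Proof.
move=> d_v; have [_ /allP met] := L_complete v.
have := met _ (map_f _ d_v); rewrite lt0n sum_nat_eq0 => /forallPn[u].
by rewrite inE /= eqb0 negbK => /andP[]; exists u.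
Qed.

Lemma demand_uniq v d u w : ~~ ntd_label (L v) -> d \in demands (L v) ->
  e v u -> L u \in d -> e v w -> L w \in d -> u = w.
Proof.
move=> role d_v evu ud evw wd; have [[_ /(_ role)/allP/(_ d d_v) le1] _] := L_complete v.
apply/eqP; apply: contraTT le1 => neq; rewrite -ltnNge /received.
by rewrite (bigD1 u) ?inE //= (bigD1 w) ?inE //= ?evu ?ud ?evw ?wd // eq_sym.
Qed.

(** [allowed] never lets an NTD label and a role be adjacent. *)
Lemma ntd_label_connect u v : connect e u v -> ntd_label (L u) = ntd_label (L v).
Proof.
case/connectP=> p + ->; elim: p u => //= w p IHp u /andP[/allowed_edge + /IHp <-].
by case: (L u); case: (L w).
Qed.

(** A vertex of $S \cap N(S)$ has a neighbour in $S$, which it puts into $N(S)$. An [Unchosen]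
    vertex is dominated by its first demand; its second gives a neighbour in $N(S)$, as [Backed] and
    [Unchosen] vertices all have neighbours in $S$. *)
Lemma chosen_ntd_set :
  (forall v, ntd_label (L v)) -> ntd_set e [set v | chosen (L v)].
Proof.
move=> ntd; set S := [set v | _].
have inS v : v \in nbhS e S = [exists u, e v u && chosen (L u)].
  apply/bigcupP/existsP=> -[u]; first by rewrite !inE e_sym => Su evu; exists u; rewrite evu.
  by case/andP=> evu Su; exists u; rewrite !inE // e_sym.
have unchosen v : v \notin S -> L v = Unchosen.
  by have := ntd v; rewrite inE; case: (L v).
have undom v : v \notin S -> v \in nbhS e S.
  move=> /unchosen Lv; have [|u evu Lu] := @demand_met v [:: Chosen; Backed].
    by rewrite Lv inE.
  by rewrite inS; apply/existsP; exists u; rewrite evu.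
apply/andP; split.
  apply/eqP/setP=> v; rewrite in_setU in_setT.
  by have [|/undom->] := boolP (v \in S); rewrite ?orbT.
apply/forall_inP=> v vN; have [vS|/unchosen Lv] := boolP (v \in S).
  move: vN; rewrite inS => /existsP[u /andP[evu Lu]].
  apply/exists_inP; exists u => //; rewrite inS; apply/existsP; exists v.
  by rewrite e_sym evu; rewrite inE in vS.
have [|u evu Lu] := @demand_met v [:: Backed; Unchosen]; first by rewrite Lv !inE eqxx orbT.
apply/exists_inP; exists u => //.
move: Lu; rewrite !inE => /orP[/eqP Lu|/eqP Lu]; last by apply: undom; rewrite inE Lu.
have [|w euw Lw] := @demand_met u [:: Chosen; Backed]; first by rewrite Lu inE.
by rewrite inS; apply/existsP; exists w; rewrite euw.
Qed.

End Labelled.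

Lemma gamma_nt_le (V : finType) (e : rel V) (S : {set V}) :
  ntd_set e S -> gamma_nt e <= #|S|.
Proof.
move=> ntdS; rewrite /gamma_nt; have := mem_index_enum S.
elim: (index_enum _) => //= A r IHr; rewrite inE big_cons => /predU1P[<-|/IHr le].
  by rewrite ntdS geq_minl.
by case: ifP => // _; apply: leq_trans (geq_minr _ _) le.
Qed.

(** * Recovering the family's construction from a labelling by roles *)

Section RoleLabelled.
Variables (V : finType) (e : rel V) (L : V -> label).
Hypothesis e_tree : is_tree e.
Hypothesis L_complete : forall v, complete e [set: V] L v.
Hypothesis L_role : forall v, ~~ ntd_label (L v).

Let e_sym : symmetric e. Proof. by case: e_tree => [[]]. Qed.

(** The default [v] arises only when no such neighbour exists, which [nbrP] excludes for demands. *)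
Definition nbr (d : seq label) v := odflt v [pick u | e v u && (L u \in d)].

Lemma nbrP d v : d \in demands (L v) -> e v (nbr d v) /\ L (nbr d v) \in d.
Proof.
move=> /(demand_met L_complete)[u evu Lu]; rewrite /nbr.
by case: pickP => [w /andP[]|/(_ u)] //; rewrite evu Lu.
Qed.

Lemma nbr_edge d v u : d \in demands (L v) -> L u \in d -> e v u = (u == nbr d v).
Proof.
move=> dv ud; have [ev Ln] := nbrP dv; apply/idP/eqP => [evu|->//].
exact: (demand_uniq L_complete (L_role v) dv).
Qed.

Lemma unique_edge d v u w : d \in demands (L v) -> L u \in d -> L w \in d ->
  e v w -> e v u = (u == w).
Proof. by move=> dv ud wd; rewrite !(nbr_edge dv) // => /eqP<-. Qed.

Lemma edge_off v u : L u \notin allowed (L v) -> e v u = false.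
Proof. by apply: contraNF; apply: allowed_edge. Qed.

(** * The tree $T_0$ of Base vertices and the tree $T_1$ *)

Local Notation U := {v : V | L v == Base}.
Implicit Types x y : U.

(** The added vertex adjacent to [x]: the middle of a $P_3$ if it is a [Hub], a single new vertex if
    it is a [Centre]. *)
Definition hook x := nbr [:: Hub; Centre] (val x).
Definition has_hub x := L (hook x) == Hub.
Definition pendant x := nbr [:: Pendant] (hook x).
Definition centre x := nbr [:: Centre] (hook x).
Local Notation T1 := (V1 U has_hub).

Lemma base_label x : L (val x) = Base. Proof. exact/eqP/(valP x). Qed.

Lemma hookP x : e (val x) (hook x) /\ L (hook x) = if has_hub x then Hub else Centre.
Proof.
have [|e_x] := @nbrP [:: Hub; Centre] (val x); first by rewrite base_label inE.
by rewrite -/(hook x) /has_hub !inE; case: eqP => //= _ /eqP.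
Qed.

Lemma pendantP x : has_hub x -> e (hook x) (pendant x) /\ L (pendant x) = Pendant.
Proof.
move=> hx; have [_] := hookP x; rewrite hx => Lh.
by have [|->] := @nbrP [:: Pendant] (hook x); rewrite ?Lh // inE => /eqP.
Qed.

Lemma centreP x : has_hub x -> e (hook x) (centre x) /\ L (centre x) = Centre.
Proof.
move=> hx; have [_] := hookP x; rewrite hx => Lh.
by have [|->] := @nbrP [:: Centre] (hook x); rewrite ?Lh // inE => /eqP.
Qed.

Definition embed1 (a : T1) : V :=
  match a with
  | inl x => val x
  | inr (existT x i) =>
      if has_hub x then
        match val i with 0 => pendant x | 1 => hook x | _ => centre x end
      else hook x
  end.

Lemma edge_hook x u : L u = Base -> e (hook x) u = (u == val x).
Proof.
move=> Lu; have [exh Lh] := hookP x; rewrite e_sym in exh.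
case: (has_hub x) Lh => Lh.
  by apply: (@unique_edge [:: Base]); rewrite ?Lh ?Lu ?base_label ?inE.
by apply: (@unique_edge [:: Base; Hub]); rewrite ?Lh ?Lu ?base_label ?inE.
Qed.

(** A [Hub] does not admit a [Hub], and a [Centre] that is a hook has met its demand by the Base
    vertex [val x]. *)
Lemma edge_hook_hub x u : L u = Hub -> e (hook x) u = false.
Proof.
move=> Lu; have [exh Lh] := hookP x; rewrite e_sym in exh.
case: (has_hub x) Lh => Lh; first by rewrite edge_off // Lh Lu.
rewrite (@unique_edge [:: Base; Hub] _ _ (val x)) ?Lh ?Lu ?base_label //.
by apply: contra_eqF Lu => /eqP->; rewrite base_label.
Qed.

Lemma edge_pendant x u :
  has_hub x -> L u = Hub -> e (pendant x) u = (u == hook x).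
Proof.
move=> hx Lu; have [ehp Lp] := pendantP hx; rewrite e_sym in ehp.
have [_] := hookP x; rewrite hx => Lh.
by apply: (@unique_edge [:: Hub]); rewrite ?Lp ?Lu ?Lh ?inE.
Qed.

Lemma edge_centre x u :
  has_hub x -> L u \in [:: Base; Hub] -> e (centre x) u = (u == hook x).
Proof.
move=> hx Lu; have [ehc Lc] := centreP hx; rewrite e_sym in ehc.
have [_] := hookP x; rewrite hx => Lh.
by apply: (@unique_edge [:: Base; Hub]); rewrite ?Lc ?Lh.
Qed.

Lemma hook_eq x y : (hook x == hook y) = (x == y).
Proof.
apply/eqP/eqP=> [eh|->//]; have [exh _] := hookP x.
by apply/val_inj/eqP; rewrite -edge_hook ?base_label // -eh e_sym.
Qed.

Lemma pendant_inj x y : has_hub x -> has_hub y -> pendant x = pendant y -> x = y.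
Proof.
move=> hx hy ep; apply/eqP; rewrite -hook_eq -edge_pendant // -?ep.
  by rewrite e_sym; case: (pendantP hx).
by have [_] := hookP x; rewrite hx.
Qed.

Lemma centre_inj x y : has_hub x -> has_hub y -> centre x = centre y -> x = y.
Proof.
move=> hx hy ec; apply/eqP; rewrite -hook_eq -edge_centre // -?ec.
  by rewrite e_sym; case: (centreP hx).
by have [_] := hookP x; rewrite hx inE => ->.
Qed.

Definition label1 (a : T1) : label :=
  match a with
  | inl x => Base
  | inr (existT x i) =>
      if has_hub x then
        match val i with 0 => Pendant | 1 => Hub | _ => Centre end
      else Centre
  end.

Lemma embed1_label a : L (embed1 a) = label1 a.
Proof.
case: a => [x|[x [m lt_m]]] /=; first exact: base_label.
have := hookP x; case: ifP => [hx|_ [_ //]] [_ Lh].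
by case: m {lt_m} => [|[|m]] //; [case: (pendantP hx)|case: (centreP hx)].
Qed.

Lemma piece_eq x y m m' (lt_m : m < if has_hub x then 3 else 1)
    (lt_m' : m' < if has_hub y then 3 else 1) :
  x = y -> m = m' ->
  inr (existT _ x (Ordinal lt_m)) = inr (existT _ y (Ordinal lt_m')) :> T1.
Proof.
move=> exy em; case: y / exy lt_m' => lt_m'; case: m' / em lt_m' => lt_m'.
by rewrite (bool_irrelevance lt_m lt_m').
Qed.

Lemma embed1_inj : injective embed1.
Proof.
move=> a b eab; have := embed1_label a; rewrite eab embed1_label.
case: a b eab => [x|[x [m lt_m]]] [y|[y [m' lt_m']]] /=.
- by move/val_inj->.
- by move=> _ elab; exfalso; move: elab; case: ifP; case: m' {lt_m'} => [|[|]].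
- by move=> _ elab; exfalso; move: elab; case: ifP; case: m {lt_m} => [|[|]].
move=> eab elab; suff [exy em] : x = y /\ m = m' by apply: piece_eq.
have [exh Lx] := hookP x; have [eyh Ly] := hookP y.
case hx: (has_hub x) eab elab lt_m Lx; case hy: (has_hub y) lt_m' Ly.
- case: m m' => [|[|[|//]]] [|[|[|//]]] // _ Ly eab _ _ Lx.
  + by split=> //; apply: pendant_inj.
  + by split=> //; apply/eqP; rewrite -hook_eq eab.
  + by split=> //; apply: centre_inj.
(* A [Centre] shared by a $P_3$ and a single-vertex gadget would have both a [Hub] and a [Base]
   neighbour, against its demand. *)
- case: m => [|[|[|//]]] // _ Ly eab _ _ Lx.
  have := edge_centre hx (_ : L (val y) \in _); rewrite base_label => /(_ isT).
  by rewrite eab e_sym eyh => /esym/eqP ey; rewrite -ey base_label in Lx.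
- case: m' => [|[|[|//]]] // _ Ly eab _ _ Lx.
  have := edge_centre hy (_ : L (val x) \in _); rewrite base_label => /(_ isT).
  by rewrite -eab e_sym exh => /esym/eqP ex; rewrite -ex base_label in Ly.
- move=> lt' Ly eab _ lt Lx; split; first by apply/eqP; rewrite -hook_eq eab.
  by case: m m' lt lt' => [|//] [].
Qed.

Lemma embed1_edge a b : e (embed1 a) (embed1 b) = e1 (relpre val e) a b.
Proof.
have base_piece x y m (lt_m : m < if has_hub y then 3 else 1) :
    e (val x) (embed1 (inr (existT _ y (Ordinal lt_m)))) =
    (x == y) && (if has_hub y then m == 1 else true).
  rewrite e_sym /=; case: ifP lt_m => hy; last first.
    by rewrite edge_hook ?base_label // andbT.
  have [_ Ly] := hookP y; rewrite hy in Ly.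
  case: m => [|[|[|//]]] _.
  - by rewrite andbF edge_off // base_label; case: (pendantP hy) => _ ->.
  - by rewrite andbT edge_hook ?base_label.
  - rewrite andbF edge_centre ?base_label //; apply/eqP=> ex.
    by have := base_label x; rewrite /= ex Ly.
case: a b => [x|[x [m lt_m]]] [y|[y [m' lt_m']]] //.
- exact: base_piece.
- by rewrite e_sym base_piece /= eq_sym.
rewrite /=; case: eqP => [exy|nexy] /=.
  case: y / exy lt_m'.
  have [exh Lx] := hookP x.
  case hx: (has_hub x) Lx lt_m => Lx; last first.
    by move=> _ _; rewrite edge_off // Lx.
  have [ep Lp] := pendantP hx; have [ec Lc] := centreP hx.
  case: m m' => [|[|[|//]]] [|[|[|//]]] //= _ _;
    rewrite ?ep ?ec 1?e_sym ?ep ?ec ?edge_off ?Lx ?Lp ?Lc //.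
(* Pieces of distinct gadgets are never adjacent: the labels forbid it, or the demand concerned is
   already met by another neighbour. *)
have hxy : (hook x == hook y) = false by rewrite hook_eq; apply/eqP.
have hyx : (hook y == hook x) = false by rewrite eq_sym.
have [_ Lx] := hookP x; have [_ Ly] := hookP y.
have centre_hook z w : has_hub z -> hook w == hook z = false ->
    L (hook w) \in [:: Base; Hub] -> e (centre z) (hook w) = false.
  by move=> hz <- Lw; apply: edge_centre.
have pendant_hook z w : has_hub z -> hook w == hook z = false ->
    L (hook w) = Hub -> e (pendant z) (hook w) = false.
  by move=> hz <- Lw; apply: edge_pendant.
case hx: (has_hub x) Lx lt_m => Lx; case hy: (has_hub y) Ly lt_m' => Ly.
- have [_ Lpx] := pendantP hx; have [_ Lcx] := centreP hx.
  have [_ Lpy] := pendantP hy; have [_ Lcy] := centreP hy.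
  case: m m' => [|[|[|//]]] [|[|[|//]]] //= _ _;
    rewrite ?pendant_hook ?centre_hook ?Lx ?Ly // 1?e_sym
      ?pendant_hook ?centre_hook ?Lx ?Ly // edge_off ?Lx ?Ly ?Lpx ?Lpy ?Lcx ?Lcy //.
- have [_ Lpx] := pendantP hx; have [_ Lcx] := centreP hx.
  case: m => [|[|[|//]]] //= _ _; last by rewrite edge_off ?Lcx ?Ly.
    by rewrite edge_off ?Lpx ?Ly.
  by rewrite e_sym edge_hook_hub.
- have [_ Lpy] := pendantP hy; have [_ Lcy] := centreP hy.
  case: m' => [|[|[|//]]] //= _ _; last by rewrite edge_off ?Lcy ?Lx.
    by rewrite edge_off ?Lpy ?Lx.
  by rewrite edge_hook_hub.
- by move=> _ _; rewrite edge_off ?Lx ?Ly.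
Qed.

Definition on_leg v := (L v == Inner) || (L v == Outer).

Lemma embed1_off_leg a : ~~ on_leg (embed1 a).
Proof.
rewrite /on_leg embed1_label; case: a => [//|[x [m lt_m]] /=].
by case: ifP; case: m {lt_m} => [|[|]].
Qed.

Lemma hook_of u v : L u = Base -> e u v -> L v \in [:: Hub; Centre] ->
  exists2 x, hook x = v & has_hub x = (L v == Hub).
Proof.
move=> Lu euv Lv; exists (exist _ u (introT eqP Lu)); last first.
  rewrite /has_hub; congr (L _ == _).
all: by apply/esym/eqP; rewrite -nbr_edge //= Lu inE.
Qed.

Lemma hub_of v : L v = Hub -> exists2 x, hook x = v & has_hub x.
Proof.
move=> Lv; have [|u evu] := @demand_met _ _ _ L_complete v [:: Base]; first by rewrite Lv.
rewrite inE e_sym in evu * => /eqP Lu.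
by have [|x] := hook_of Lu evu; rewrite Lv // eqxx; exists x.
Qed.

Lemma embed1_onto v : ~~ on_leg v -> exists a, embed1 a = v.
Proof.
have in3 x m : has_hub x -> m < 3 -> m < if has_hub x then 3 else 1 by move=> ->.
rewrite /on_leg; have := L_role v; case Lv: (L v) => // _ _.
- by exists (inl (exist _ v (introT eqP Lv))).
- have [x exv hx] := hub_of Lv.
  by exists (inr (existT _ x (Ordinal (in3 x 1 hx isT)))); rewrite /= hx.
- have [|u evu] := @demand_met _ _ _ L_complete v [:: Hub]; first by rewrite Lv.
  rewrite inE e_sym in evu * => /eqP Lu; have [x exu hx] := hub_of Lu.
  exists (inr (existT _ x (Ordinal (in3 x 0 hx isT)))); rewrite /= hx.
  by apply/esym/eqP; rewrite -nbr_edge ?exu ?Lu ?Lv.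
- have [|u evu] := @demand_met _ _ _ L_complete v [:: Base; Hub]; first by rewrite Lv.
  (* A [Centre] hangs from a [Base] as a single added vertex, or from a [Hub] as an end of a
     $P_3$. *)
  rewrite !inE e_sym in evu * => /orP[] /eqP Lu.
    have [|x exv hx] := hook_of Lu evu; first by rewrite Lv.
    rewrite Lv in hx.
    have lt01 : 0 < if has_hub x then 3 else 1 by rewrite hx.
    by exists (inr (existT _ x (Ordinal lt01))); rewrite /= hx.
  have [x exu hx] := hub_of Lu.
  exists (inr (existT _ x (Ordinal (in3 x 2 hx isT)))); rewrite /= hx.
  by apply/esym/eqP; rewrite -nbr_edge ?exu ?Lu ?Lv.
Qed.

(** * The attached copies of $P_2$ and the whole tree *)

Definition inners v := enum [set u | e v u && (L u == Inner)].
(** The multiplicities $k$; they vanish off the Centres, the only vertices of $T_1$ that admit an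
    [Inner] neighbour. *)
Definition legs (a : T1) := size (inners (embed1 a)).
Definition outer v := nbr [:: Outer] v.
Local Notation T2 := (V2 U has_hub legs).

Definition embed2 (a : T2) : V :=
  match a with
  | inl a => embed1 a
  | inr (existT a (i, t)) =>
      let w := nth (embed1 a) (inners (embed1 a)) i in
      if t then outer w else w
  end.

Definition leg_inner a (i : 'I_(legs a)) := nth (embed1 a) (inners (embed1 a)) i.

Lemma leg_innerP a (i : 'I_(legs a)) :
  [/\ L (leg_inner i) = Inner, e (embed1 a) (leg_inner i) & L (embed1 a) = Centre].
Proof.
have : leg_inner i \in inners (embed1 a) by apply: mem_nth; apply: ltn_ord.
rewrite mem_enum inE => /andP[eai /eqP Li]; split=> //.
have := allowed_edge L_complete eai; have := embed1_off_leg a; rewrite /on_leg Li.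
by case: (L (embed1 a)) (L_role (embed1 a)).
Qed.

Lemma outerP v : L v = Inner -> e v (outer v) /\ L (outer v) = Outer.
Proof.
by move=> Lv; have [|->] := @nbrP [:: Outer] v; rewrite ?Lv // inE => /eqP.
Qed.

Lemma edge_outer v u : L v = Inner -> L u = Inner -> e (outer v) u = (u == v).
Proof.
move=> Lv Lu; have [evo Lo] := outerP Lv; rewrite e_sym in evo.
by apply: (@unique_edge [:: Inner]); rewrite ?Lo ?Lu ?Lv ?inE.
Qed.

Lemma outer_inj u v : L u = Inner -> L v = Inner -> outer u = outer v -> u = v.
Proof.
move=> Lu Lv euv; have [evo _] := outerP Lu.
by apply/eqP; rewrite -edge_outer // -euv e_sym.
Qed.

Lemma edge_leg_inner a (i : 'I_(legs a)) b :
  e (leg_inner i) (embed1 b) = (b == a).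
Proof.
have [Li eai Lc] := leg_innerP i.
rewrite -(inj_eq embed1_inj); have [->|neq] := eqVneq (embed1 b).
  by rewrite e_sym.
apply: contraNF neq => eib; have Lb : L (embed1 b) = Centre.
  have := allowed_edge L_complete eib; have := embed1_off_leg b.
  by rewrite /on_leg Li; case: (L (embed1 b)).
rewrite e_sym in eai; apply/eqP.
apply: (@demand_uniq _ _ _ L_complete (leg_inner i) [:: Centre]) => //.
all: by rewrite ?Li ?Lb ?Lc ?inE.
Qed.

Lemma leg_inner_inj a b (i : 'I_(legs a)) (j : 'I_(legs b)) :
  leg_inner i = leg_inner j -> a = b /\ val i = val j.
Proof.
move=> eij; have eab : a = b by apply/eqP; rewrite -(edge_leg_inner j) -eij edge_leg_inner.
case: b / eab j eij => j eij; split=> //; apply/eqP.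
by rewrite -(nth_uniq (embed1 a) (ltn_ord i) (ltn_ord j) (enum_uniq _)); apply/eqP.
Qed.

Lemma leg_eq a b (i : 'I_(legs a)) (j : 'I_(legs b)) (t : bool) :
  a = b -> val i = val j -> inr (existT _ a (i, t)) = inr (existT _ b (j, t)) :> T2.
Proof. by move=> eab; case: b / eab j => j /val_inj->. Qed.

Lemma embed2_inj : injective embed2.
Proof.
have off a (i : 'I_(legs a)) t b : embed1 b <> embed2 (inr (existT _ a (i, t))).
  move=> eb; have := embed1_off_leg b; rewrite eb /on_leg /= -/(leg_inner i).
  have [Li _ _] := leg_innerP i; have [_ Lo] := outerP Li.
  by case: t {eb}; rewrite ?Li ?Lo.
move=> [a|[a [i t]]] [b|[b [j s]]].
- by move/embed1_inj->.
- by move/off.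
- by move/esym/off.
have [Li _ _] := leg_innerP i; have [_ Lio] := outerP Li.
have [Lj _ _] := leg_innerP j; have [_ Ljo] := outerP Lj.
rewrite /= -/(leg_inner i) -/(leg_inner j).
case: t; case: s.
- by move/(outer_inj Li Lj)/leg_inner_inj => [? ?]; apply: leg_eq.
- by move=> eij; rewrite eij Lj in Lio.
- by move=> eij; rewrite -eij Li in Ljo.
- by move/leg_inner_inj => [? ?]; apply: leg_eq.
Qed.

Lemma embed2_onto v : exists a, embed2 a = v.
Proof.
have inner w : L w = Inner -> exists a, exists i : 'I_(legs a), leg_inner i = w.
  move=> Lw; have [|u ewu] := @demand_met _ _ _ L_complete w [:: Centre]; first by rewrite Lw.
  rewrite inE => /eqP Lu; have [|a eau] := @embed1_onto u; first by rewrite /on_leg Lu.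
  have w_in : w \in inners (embed1 a) by rewrite mem_enum inE eau e_sym ewu Lw /=.
  exists a; have lt_w : index w (inners (embed1 a)) < legs a by rewrite index_mem.
  by exists (Ordinal lt_w); apply: nth_index.
have [|/embed1_onto[a ea]] := boolP (on_leg v); last by exists (inl a).
case/orP=> /eqP Lv.
  by have [a [i ei]] := inner v Lv; exists (inr (existT _ a (i, false))).
have [|w evw] := @demand_met _ _ _ L_complete v [:: Inner]; first by rewrite Lv.
rewrite inE => /eqP Lw; have [a [i ei]] := inner w Lw.
exists (inr (existT _ a (i, true))); rewrite /= -/(leg_inner i) ei.
by apply/esym/eqP; rewrite -nbr_edge ?Lw ?Lv // e_sym.
Qed.

Lemma embed2_edge a b : e (embed2 a) (embed2 b) = e2 (relpre val e) a b.
Proof.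
have base_leg a' b' (i : 'I_(legs b')) t :
    e (embed1 a') (embed2 (inr (existT _ b' (i, t)))) = (a' == b') && ~~ t.
  rewrite e_sym /= -/(leg_inner i); case: t; last by rewrite edge_leg_inner andbT.
  have [Li _ _] := leg_innerP i; have [_ Lo] := outerP Li.
  rewrite andbF edge_off // Lo inE; have := embed1_off_leg a'.
  by rewrite /on_leg; case: eqP.
case: a b => [a|[a [i t]]] [b|[b [j s]]].
- exact: embed1_edge.
- exact: base_leg.
- by rewrite e_sym base_leg /= eq_sym.
have [Li _ _] := leg_innerP i; have [_ Lio] := outerP Li.
have [Lj _ _] := leg_innerP j; have [_ Ljo] := outerP Lj.
have same : (leg_inner i == leg_inner j) = (a == b) && (val i == val j).
  apply/eqP/andP=> [/leg_inner_inj[eab ->]|[/eqP eab /eqP eij]].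
    by rewrite eab !eqxx.
  by case: b / eab j eij {Lj Ljo} => j /val_inj->.
rewrite /= -/(leg_inner i) -/(leg_inner j) -same.
case: t; case: s; rewrite ?andbT ?andbF.
- by rewrite edge_off // Lio Ljo.
- by rewrite edge_outer // eq_sym.
- by rewrite e_sym edge_outer.
- by rewrite edge_off // Li Lj.
Qed.

(** * Contraction onto $T_0$ and membership in the family *)

Definition base1 (a : T1) : U := match a with inl x => x | inr (existT x _) => x end.

Definition base2 (a : T2) : U :=
  match a with inl a => base1 a | inr (existT a _) => base1 a end.

Lemma base2_edge a b :
  e2 (relpre val e) a b -> base2 a = base2 b \/ e (val (base2 a)) (val (base2 b)).
Proof.
case: a b => [[x|[x i]]|[a [i t]]] [[y|[y j]]|[b [j s]]] //=; try by right.
all: by rewrite -?andbA => /andP[/eqP eab _]; left; first [rewrite eab | rewrite -eab].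
Qed.

(** Contracting each gadget with its legs onto its base vertex projects walks of the tree to walks
    of $T_0$, giving connectedness; a cycle of $T_0$ would be one of the tree. *)
Lemma base_tree : is_tree (relpre val e : rel U).
Proof.
have [[_ e_irr] V_gt0 conn acyc] := e_tree.
have walk p a b : path e (embed2 a) p -> embed2 b = last (embed2 a) p ->
    connect (relpre val e) (base2 a) (base2 b).
  elim: p a => [|v p IHp] a /=; first by move=> _ /embed2_inj->; apply: connect0.
  have [c <-] := embed2_onto v; rewrite embed2_edge.
  case/andP=> /base2_edge eac /IHp{}IHp /IHp.
  by case: eac => [->//|eac]; apply: connect_trans; apply: connect1.
have connected_base : connected (relpre val e : rel U).
  move=> x y; have /connectP[p] := conn (val x) (val y).
  exact: (walk p (inl (inl x)) (inl (inl y))).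
split=> //.
- by split=> [x y|x] /=; [apply: e_sym|apply: e_irr].
- have [v _] := card_gt0P V_gt0; have [a _] := embed2_onto v.
  by apply/card_gt0P; exists (base2 a).
- case=> x [p [uq lt_p pth cyc]]; apply: acyc; exists (val x), (map val p); split.
  + by rewrite -map_cons map_inj_uniq //; apply: val_inj.
  + by rewrite size_map.
  + by rewrite path_map.
  + by rewrite last_map.
Qed.

Lemma role_labelled_family : in_family_T e.
Proof.
(* $L_1$ consists of all Centres, including those that carry no $P_2$, since $k = 0$ is
   permitted. *)
exists U, (relpre val e), has_hub, [set a | L (embed1 a) == Centre], legs; split.
- exact: base_tree.
- move=> a; rewrite inE => /eqP La; rewrite /is_leaf.
  (* [Inner] neighbours lie outside $T_1$, so the one [Base] or [Hub] neighbour is all that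
     counts. *)
  have [|eau Lu] := @nbrP [:: Base; Hub] (embed1 a); first by rewrite La.
  have [|b eb] := @embed1_onto (nbr [:: Base; Hub] (embed1 a)).
    by move: Lu; rewrite /on_leg !inE => /orP[] /eqP->.
  apply/eqP/(eq_card1 (x := b)) => w; rewrite !inE -embed1_edge -(inj_eq embed1_inj) eb.
  have [|off_w] := boolP (L (embed1 w) \in [:: Base; Hub]).
    by move=> Lw; rewrite (@nbr_edge [:: Base; Hub]) ?La.
  rewrite edge_off; first by apply/esym; apply: contraNF off_w => /eqP->.
  have := embed1_off_leg w; rewrite La /on_leg.
  by move: off_w; case: (L (embed1 w)).
- move=> a b; rewrite !inE => /eqP La /eqP Lb neq; rewrite -embed1_edge edge_off ?La ?Lb //.
  split=> // -[w /andP[]]; rewrite -!embed1_edge => eaw ewb.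
  case/eqP: neq; apply: embed1_inj; rewrite e_sym in eaw.
  (* A common neighbour in $T_1$ is a [Base] or a [Hub], and each has a demand that admits just one
     [Centre]. *)
  have [d dw Cd] : exists2 d, d \in demands (L (embed1 w)) & Centre \in d.
    have := allowed_edge L_complete ewb; have := embed1_off_leg w; rewrite /on_leg Lb.
    case: (L (embed1 w)) (L_role (embed1 w)) => // _ _ _.
    + by exists [:: Hub; Centre].
    + by exists [:: Centre].
  by apply: (demand_uniq L_complete (L_role (embed1 w)) dw); rewrite ?La ?Lb.
- move=> a; rewrite inE => La; apply/eqP; rewrite size_eq0; apply/eqP.
  case E: (inners _) => [//|v s]; have : v \in inners (embed1 a) by rewrite E mem_head.
  rewrite mem_enum inE => /andP[eav /eqP Lv]; case/negP: La.
  have := allowed_edge L_complete eav; have := embed1_off_leg a; rewrite /on_leg Lv.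
  by case: (L (embed1 a)) (L_role (embed1 a)).
have [f fK] : exists f, cancel f embed2.
  have ex v : exists a, embed2 a == v by have [a <-] := embed2_onto v; exists a.
  by exists (fun v => xchoose (ex v)) => v; apply/eqP; apply: (xchooseP (ex v)).
exists f; split=> [|x y]; last by rewrite -embed2_edge !fK.
by exists embed2 => // a; apply: embed2_inj; rewrite fK.
Qed.

End RoleLabelled.

(** * Trees whose neighborhood total domination number is half the order *)

Theorem theorem4p1 (V : finType) (e : rel V) :
  is_tree e -> 4 <= #|V| -> (gamma_nt e).*2 = #|V| -> in_family_T e.
Proof.
move=> tree_e _ gammaE; have [[e_sym e_irr] /card_gt0P[r _] conn _] := tree_e.
have [s acc [parity real]] := assembled_accepting e_sym e_irr (tree_assembled r tree_e).
(* The order is twice [gamma_nt e], hence even, which rules out the first outcome. *)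
move: acc; rewrite /accepting parity cardsT -gammaE odd_double /=.
case/hasP=> x /real[L [<- root_ok rest_ok le_sum]] /andP[met small].
have L_complete v : complete e [set: V] L v.
  by have [->|neq] := eqVneq v r; [split|apply: rest_ok; rewrite ?inE].
have ntdE v : ntd_label (L v) = ntd_label (L r).
  exact: (ntd_label_connect L_complete (conn v r)).
case: (boolP (ntd_label (L r))) small => [ntd|role _]; last first.
  by apply: (role_labelled_family tree_e L_complete) => v; rewrite ntdE.
move=> small; have ntdS : ntd_set e [set v | chosen (L v)].
  by apply: (chosen_ntd_set e_sym L_complete) => v; rewrite ntdE.
have := gamma_nt_le ntdS; move: le_sum.
have -> : \sum_(v in [set: V]) chosen (L v) = #|[set v | chosen (L v)]|.
  rewrite -sum1_card big_mkcond [RHS]big_mkcond; apply: eq_bigr => v _.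
  by rewrite !inE; case: chosen.
(* From $2|S| + 2 \le n + b$ and $b < 2$ follows $2|S| < n = 2\gamma_{nt}$, contradicting
   minimality. *)
rewrite cardsT -gammaE; move: x.2 small => b lt_b lt_S le_S; exfalso; lia.
Qed.
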